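(* Let $B_i,A_j\in\mathbb{M}_N$ for $1\le i\le m$, $1\le j\le n$ satisfy $(B_1,\ldots,B_m)^T=U(A_1,\ldots,A_n)^T$, i.e. $B_i=\sum_{j=1}^n u_{ij}A_j$ for all $i$, for some $m\times n$ complex isometry $U=(u_{ij})$ (that is, $U^*U=I_n$). Then for $p\ge2$ there exist unitaries $U_1,\dots,U_m,V_1,\dots,V_n\in\mathbb{M}_N$ such that $$\sum_{i=1}^m U_i|B_i|_{\mathrm{qsym}}^pU_i^*\le n^{\frac p2-1}\sum_{j=1}^n|A_j|_{\mathrm{qsym}}^p,$$ $$\sum_{j=1}^n V_j|A_j|_{\mathrm{qsym}}^pV_j^*\le m^{\frac p2-1}\sum_{i=1}^m|B_i|_{\mathrm{qsym}}^p.$$ For $0<p\le2$, the inequalities are reversed; that is, there exist unitaries $U_i,V_j\in\mathbb{M}_N$ such that both inequalities hold with $\le$ replaced by $\ge$.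
   Context: $\mathbb{M}_N$ is the space of $N\times N$ complex matrices. For $Z\in\mathbb{M}_N$, the quadratic symmetric modulus is $|Z|_{\mathrm{qsym}}=\left(\frac{Z^*Z+ZZ^*}{2}\right)^{1/2}$, and $|Z|_{\mathrm{qsym}}^p$ is its $p$-th power. For Hermitian matrices, $X\le Y$ means $Y-X$ is positive semidefinite. *)

(* Defs.v *)
From mathcomp Require Import all_boot all_order all_algebra.
From mathcomp Require Import reals exp.
From mathcomp Require Import complex.

Set Implicit Arguments.
Unset Strict Implicit.
Unset Printing Implicit Defensive.

Import Order.TTheory GRing.Theory Num.Theory.
Local Open Scope ring_scope.
Local Open Scope complex_scope.
Local Open Scope sesquilinear_scope.

Section QuadraticSymmetricModulus.
Context {R : realType} {N : nat}.
Implicit Types A X Y Z : 'M[R[i]]_N.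

(* In R[i], [0 <= z] means that z is real and nonnegative. *)
Definition psdmx A : Prop :=
  A \is hermsymmx /\ forall v : 'cV[R[i]]_N, 0 <= (v^t* *m A *m v) 0 0.

Definition loewner_le X Y : Prop := psdmx (Y - X).

(* The real power A^p of a positive semidefinite A, by functional calculus:
   the library gives A = invmx P *m diag_mx d *m P with P = spectralmx A
   unitary and d = spectral_diag A, and the (nonnegative) eigenvalues d 0 i
   are raised to the power p.  As [0 `^ p = 0] for p != 0, this is the usual
   power on singular A when p > 0.  The value is meaningless if A is not
   positive semidefinite. *)
Definition mxpowR A (p : R) : 'M[R[i]]_N :=
  invmx (spectralmx A)
    *m diag_mx (map_mx (fun z : R[i] => (complex.Re z `^ p)%:C)
                       (spectral_diag A))
    *m spectralmx A.

Definition qsym Z : 'M[R[i]]_N :=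
  mxpowR (2^-1 *: (Z^t* *m Z + Z *m Z^t*)) 2^-1.

End QuadraticSymmetricModulus.

(* Main.v *)
(** With S(Z) = (Z^* Z + Z Z^* ) / 2 and r = p/2, |Z|_qsym^p = S(Z)^r, and the
    isometry gives sum_i S(B_i) = sum_j S(A_j) =: T.  Both inequalities are
    obtained by comparing each side with T^r, up to unitary conjugation.

    Comparison of eigenvalues: a psd matrix A is below a unitary conjugate of
    B as soon as, for each c > 0, some matrix L sends every nonzero vector of
    the spectral subspace {A >= c} outside of {B < c}.  Quadratic forms of
    powers are controlled by the tangent lines of t |-> t^r.

    - Jensen: T^r is comparable with n^(r-1) sum_j Y_j^r, for T = sum_j Y_j.
    - Super/subadditivity: for T = sum_i X_i, the contractions
      K_i = X_i^(1/2) T^(-1/2) satisfy K_i T K_i^* = X_i and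
      sum_i C_i^* C_i = T^r, where C_i = K_i T^(r/2); finally
      C_i C_i^* = K_i T^r K_i^* is compared with (K_i T K_i^* )^r = X_i^r, and
      C_i^* C_i has the same eigenvalues as C_i C_i^*. *)

Require Import Defs.
From mathcomp Require Import all_boot all_order all_algebra.
From mathcomp Require Import reals exp.
From mathcomp Require Import complex.
From mathcomp Require Import fingroup perm ring lra.

Set Implicit Arguments.
Unset Strict Implicit.
Unset Printing Implicit Defensive.

Import Order.TTheory GRing.Theory Num.Theory.
Local Open Scope ring_scope.
Local Open Scope complex_scope.
Local Open Scope sesquilinear_scope.

(** * Algebra of the conjugate transpose *)

Section Adjoint.
Context {R : realType}.
Implicit Types m n k : nat.

Lemma adjmxE m n (A : 'M[R[i]]_(m, n)) i j : A^t* i j = Num.conj (A j i).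
Proof. by rewrite !mxE. Qed.

Lemma adjmxM m n k (A : 'M[R[i]]_(m, n)) (B : 'M[R[i]]_(n, k)) :
  (A *m B)^t* = B^t* *m A^t*.
Proof. by rewrite trmx_mul map_mxM. Qed.

Lemma adjmxM_herm n (A B : 'M[R[i]]_n) :
  A^t* = A -> B^t* = B -> (A *m B)^t* = B *m A.
Proof. by move=> hA hB; rewrite adjmxM hA hB. Qed.

Lemma adjmxD m n (A B : 'M[R[i]]_(m, n)) : (A + B)^t* = A^t* + B^t*.
Proof. by rewrite linearD /= map_mxD. Qed.

Lemma adjmxB m n (A B : 'M[R[i]]_(m, n)) : (A - B)^t* = A^t* - B^t*.
Proof. by rewrite linearB /= map_mxB. Qed.

Lemma adjmxZ m n (z : R[i]) (A : 'M[R[i]]_(m, n)) :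
  (z *: A)^t* = Num.conj z *: A^t*.
Proof. by rewrite linearZ /= map_mxZ. Qed.

Lemma adjmx_sum m n (I : Type) (s : seq I) (P : pred I)
    (F : I -> 'M[R[i]]_(m, n)) :
  (\sum_(i <- s | P i) F i)^t* = \sum_(i <- s | P i) (F i)^t*.
Proof. by rewrite raddf_sum -[LHS]/(map_mx _ _) raddf_sum. Qed.

Lemma conjC_real (x : R) : Num.conj x%:C = x%:C.
Proof. by rewrite -[LHS]/(conjc _) conjc_real. Qed.

Lemma adjmxZ_real m n (x : R) (A : 'M[R[i]]_(m, n)) :
  (x%:C *: A)^t* = x%:C *: A^t*.
Proof. by rewrite adjmxZ conjC_real. Qed.

Lemma adj_unitarymx n (P : 'M[R[i]]_n) : P \is unitarymx -> P^t* \is unitarymx.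
Proof. by rewrite trmxC_unitary. Qed.

Lemma mul_adj_unitarymx n (P : 'M[R[i]]_n) :
  P \is unitarymx -> P^t* *m P = 1%:M.
Proof. by rewrite -trmxC_unitary => /unitarymxP; rewrite trmxCK. Qed.

End Adjoint.

(** * Real quadratic forms and the Loewner order *)

Section QuadraticForm.
Context {R : realType} {N : nat}.
Implicit Types (A B M K W : 'M[R[i]]_N) (v : 'cV[R[i]]_N) (x : R).

(** Taking the real part gives values in [R] for every matrix, so that inequalities between forms
    are plain real arithmetic. For Hermitian [M] nothing is lost. *)
Definition qform M v : R := complex.Re ((v^t* *m M *m v) 0 0).

Lemma qformD A B v : qform (A + B) v = qform A v + qform B v.
Proof. by rewrite /qform mulmxDr mulmxDl mxE raddfD. Qed.

Lemma qformZ x A v : qform (x%:C *: A) v = x * qform A v.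
Proof.
rewrite /qform -scalemxAr -scalemxAl mxE.
by case: (_ 0 0) => u w /=; rewrite mul0r subr0.
Qed.

Lemma qformN A v : qform (- A) v = - qform A v.
Proof. by rewrite /qform mulmxN mulNmx mxE raddfN. Qed.

Lemma qformB A B v : qform (A - B) v = qform A v - qform B v.
Proof. by rewrite qformD qformN. Qed.

Lemma qform0 v : qform 0 v = 0.
Proof. by rewrite /qform mulmx0 mul0mx mxE. Qed.

Lemma qform_sum (I : Type) (s : seq I) (P : pred I) (F : I -> 'M[R[i]]_N) v :
  qform (\sum_(i <- s | P i) F i) v = \sum_(i <- s | P i) qform (F i) v.
Proof.
by apply: (big_morph (fun M => qform M v)) => [A B|]; rewrite ?qformD ?qform0.
Qed.

Lemma qform_congr K A v : qform (K^t* *m A *m K) v = qform A (K *m v).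
Proof. by rewrite /qform adjmxM !mulmxA. Qed.

Lemma qform_gram K v : qform (K^t* *m K) v = qform 1%:M (K *m v).
Proof. by rewrite -qform_congr mulmx1. Qed.

Lemma qform1E v :
  qform 1%:M v = \sum_i (complex.Re (v i 0) ^+ 2 + complex.Im (v i 0) ^+ 2).
Proof.
rewrite /qform mulmx1 mxE raddf_sum; apply: eq_bigr => i _.
rewrite !mxE -[Num.conj _]/(conjc _); case: (v i 0) => a b /=.
by rewrite mulNr opprK -!expr2.
Qed.

Lemma qform1_ge0 v : 0 <= qform 1%:M v.
Proof. by rewrite qform1E sumr_ge0 // => i _; rewrite addr_ge0 ?sqr_ge0. Qed.

Lemma qform1_gt0 v : v != 0 -> 0 < qform 1%:M v.
Proof.
move=> v0; rewrite lt_def qform1_ge0 andbT; apply: contra_neq v0.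
rewrite qform1E => /eqP; rewrite psumr_eq0 => [|i _]; last first.
  by rewrite addr_ge0 ?sqr_ge0.
move=> /allP v0; apply/matrixP => i j; rewrite ord1 mxE.
have := v0 i (mem_index_enum _); rewrite paddr_eq0 ?sqr_ge0 // !sqrf_eq0.
by case: (v i 0) => a b /= /andP[/eqP-> /eqP->].
Qed.

(** When [A] is Hermitian, the scalar v^* A v equals its own conjugate, so its imaginary part
    vanishes and the order of [R[i]] only tests the real part. *)
Lemma psdP A : psdmx A <-> A^t* = A /\ forall v, 0 <= qform A v.
Proof.
have hE : (A \is hermsymmx) = (A == A^t*).
  by rewrite qualifE /= expr0 scale1r.
split=> [[]|[hA A0]].
  rewrite hE => /eqP hA A0; split=> // v; have := A0 v.
  by rewrite /qform lecE /= => /andP[].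
split=> [|v]; first by rewrite hE hA.
have hv : (v^t* *m A *m v)^t* = v^t* *m A *m v.
  by rewrite !adjmxM trmxCK hA mulmxA.
have {}hv : Num.conj ((v^t* *m A *m v) 0 0) = (v^t* *m A *m v) 0 0.
  by rewrite -{2}hv adjmxE.
have := A0 v; rewrite /qform; case: (_ 0 0) hv => a b; rewrite lecE /= => -[] /eqP.
by rewrite eq_sym -subr_eq0 opprK -mulr2n mulrn_eq0 /= => /eqP-> ->; rewrite eqxx.
Qed.

Lemma loewnerI A B : A^t* = A -> B^t* = B ->
  (forall v, qform A v <= qform B v) -> loewner_le A B.
Proof.
move=> hA hB AB; apply/psdP; rewrite adjmxB hA hB; split=> [//|v].
by rewrite qformB subr_ge0.
Qed.

Lemma psdmxD A B : psdmx A -> psdmx B -> psdmx (A + B).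
Proof.
move=> /psdP[hA A0] /psdP[hB B0]; apply/psdP; rewrite adjmxD hA hB.
by split=> [//|v]; rewrite qformD addr_ge0.
Qed.

Lemma psdmxZ x A : 0 <= x -> psdmx A -> psdmx (x%:C *: A).
Proof.
move=> x0 /psdP[hA A0]; apply/psdP; rewrite adjmxZ_real hA.
by split=> [//|v]; rewrite qformZ mulr_ge0.
Qed.

Lemma psdmx0 : psdmx (0 : 'M[R[i]]_N).
Proof. by apply/psdP; split=> [|v]; rewrite ?qform0 // linear0 map_mx0. Qed.

Lemma psdmx_sum (I : Type) (s : seq I) (F : I -> 'M[R[i]]_N) :
  (forall i, psdmx (F i)) -> psdmx (\sum_(i <- s) F i).
Proof. by move=> psdF; apply: (big_ind _ psdmx0 psdmxD) => i _; exact: psdF. Qed.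

Lemma psdmx_congr K A : psdmx A -> psdmx (K^t* *m A *m K).
Proof.
move=> /psdP[hA A0]; apply/psdP; split=> [|v]; last by rewrite qform_congr.
by rewrite !adjmxM trmxCK hA mulmxA.
Qed.

Lemma psdmx_gram K : psdmx (K^t* *m K).
Proof.
apply/psdP; split=> [|v]; first by rewrite adjmxM trmxCK.
by rewrite qform_gram qform1_ge0.
Qed.

Lemma loewner_le_trans A B M : loewner_le A B -> loewner_le B M -> loewner_le A M.
Proof. by move=> AB /psdmxD/(_ AB); rewrite addrA subrK. Qed.

Lemma loewner_le_sum (I : Type) (s : seq I) (F G : I -> 'M[R[i]]_N) :
  (forall i, loewner_le (F i) (G i)) ->
  loewner_le (\sum_(i <- s) F i) (\sum_(i <- s) G i).
Proof. by move=> FG; rewrite /loewner_le -sumrB; exact: psdmx_sum. Qed.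

Lemma loewner_le_congr K A B :
  loewner_le A B -> loewner_le (K^t* *m A *m K) (K^t* *m B *m K).
Proof. by move=> /(psdmx_congr K); rewrite mulmxBr mulmxBl. Qed.

(** Moves a unitary from the smaller side to the larger one, as the reversed inequalities
    require. *)
Lemma loewner_le_unitary W A B : W \is unitarymx ->
  loewner_le (W *m A *m W^t*) B -> loewner_le A (W^t* *m B *m W).
Proof.
move=> uW /(loewner_le_congr W); rewrite -(mulmxA W A) (mulmxA (W^t*) W).
by rewrite (mul_adj_unitarymx uW) mul1mx -(mulmxA A) (mul_adj_unitarymx uW) mulmx1.
Qed.

End QuadraticForm.

(** * Unitarily diagonalized matrices and independence of the functional calculus from the
    eigenbasis *)

Section UnitaryDiagonal.
Context {R : realType} {N : nat}.
Implicit Types (A B M K P Q W : 'M[R[i]]_N) (v : 'cV[R[i]]_N) (x c : R).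
Implicit Types (a b : 'I_N -> R).

(** Eigenvalues are kept as a real function, so that real powers and the order of [R] apply to them
    directly. *)
Definition rdiag a : 'M[R[i]]_N := diag_mx (\row_i (a i)%:C).

Definition udiag P a : 'M[R[i]]_N :=
  P^t* *m rdiag a *m P.

Lemma rdiagE a i j : rdiag a i j = (a i)%:C *+ (i == j).
Proof. by rewrite !mxE. Qed.

Lemma rdiagM a b : rdiag a *m rdiag b = rdiag (fun i => a i * b i).
Proof. by apply/matrixP => i j; rewrite /rdiag mul_diag_mx !mxE rmorphM mulrnAr. Qed.

Lemma adj_rdiag a : (rdiag a)^t* = rdiag a.
Proof.
apply/matrixP => i j; rewrite adjmxE !rdiagE.
by rewrite eq_sym; case: eqVneq => [->|_]; rewrite ?mulr0n ?mulr1n ?rmorph0 ?conjC_real.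
Qed.

Lemma udiag_adj P a : (udiag P a)^t* = udiag P a.
Proof. by rewrite /udiag !adjmxM trmxCK adj_rdiag mulmxA. Qed.

Lemma udiagM P a b : P \is unitarymx ->
  udiag P a *m udiag P b = udiag P (fun i => a i * b i).
Proof.
move=> uP; rewrite /udiag -rdiagM -[LHS]mulmxA (mulmxA P (P^t* *m _)).
by rewrite (mulmxA P (P^t*)) (unitarymxP uP) mul1mx !mulmxA.
Qed.

Lemma eq_udiag P a b : a =1 b -> udiag P a = udiag P b.
Proof.
move=> ab; rewrite /udiag (_ : rdiag a = rdiag b) //.
by apply/matrixP => i j; rewrite !rdiagE ab.
Qed.

Lemma udiagZ P x a : x%:C *: udiag P a = udiag P (fun i => x * a i).
Proof.
rewrite /udiag (_ : rdiag (fun i => x * a i) = x%:C *: rdiag a).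
  by rewrite -scalemxAr -scalemxAl.
by apply/matrixP => i j; rewrite [RHS]mxE !rdiagE rmorphM mulrnAr.
Qed.

Lemma udiag1 P : P \is unitarymx -> udiag P (fun=> 1) = 1%:M.
Proof.
move=> uP; rewrite /udiag (_ : rdiag _ = 1%:M) ?mulmx1 ?mul_adj_unitarymx //.
by apply/matrixP => i j; rewrite rdiagE mxE.
Qed.

Lemma udiagD P a b : udiag P a + udiag P b = udiag P (fun i => a i + b i).
Proof.
rewrite /udiag (_ : rdiag (fun i => a i + b i) = rdiag a + rdiag b).
  by rewrite mulmxDr mulmxDl.
by apply/matrixP => i j; rewrite [RHS]mxE !rdiagE rmorphD mulrnDl.
Qed.

Lemma qform_diag a v : qform (rdiag a) v
  = \sum_i a i * (complex.Re (v i 0) ^+ 2 + complex.Im (v i 0) ^+ 2).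
Proof.
rewrite /qform mul_mx_diag mxE raddf_sum; apply: eq_bigr => i _.
rewrite !mxE -[Num.conj _]/(conjc _); case: (v i 0) => u w /=; ring.
Qed.

Lemma qform_udiagE P a v : qform (udiag P a) v
  = \sum_i a i * (complex.Re ((P *m v) i 0) ^+ 2 + complex.Im ((P *m v) i 0) ^+ 2).
Proof. by rewrite qform_congr qform_diag. Qed.

Lemma qform_udiag_le P a b v : (forall i, a i <= b i) ->
  qform (udiag P a) v <= qform (udiag P b) v.
Proof.
move=> ab; rewrite !qform_udiagE; apply: ler_sum => i _.
by rewrite ler_wpM2r // addr_ge0 ?sqr_ge0.
Qed.

Lemma udiag_psd P a : (forall i, 0 <= a i) -> psdmx (udiag P a).
Proof.
move=> a0; apply/psdP; split=> [|v]; first exact: udiag_adj.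
rewrite qform_udiagE sumr_ge0 // => i _.
by rewrite mulr_ge0 // addr_ge0 ?sqr_ge0.
Qed.

Lemma qform1_unitary P v : P \is unitarymx ->
  qform 1%:M (P *m v) = qform 1%:M v.
Proof. by move=> uP; rewrite -qform_gram mul_adj_unitarymx. Qed.

Lemma udiag_conj P Q a : Q \is unitarymx ->
  (P^t* *m Q) *m udiag Q a *m (P^t* *m Q)^t* = udiag P a.
Proof.
by move=> uQ; rewrite /udiag adjmxM trmxCK !mulmxA !mulmxtVK.
Qed.

(* The entries of [M] vanish unless the corresponding diagonal entries agree. *)
Lemma rdiag_intertwine M a b (f : R -> R) : rdiag a *m M = M *m rdiag b ->
  rdiag (f \o a) *m M = M *m rdiag (f \o b).
Proof.
move=> E; apply/matrixP => i j; have := congr1 (fun X : 'M_N => X i j) E.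
rewrite /= /rdiag !mul_diag_mx !mul_mx_diag !mxE.
have [->|M0] := eqVneq (M i j) 0; first by rewrite !mul0r !mulr0.
rewrite mulrC => /(mulfI M0) /eqP; rewrite eq_complex /= eqxx andbT => /eqP ->.
by rewrite mulrC.
Qed.

(** The unitary P Q^* intertwines the two diagonal matrices, hence also their images under [f]. Thus
    a function of a matrix may be computed in any eigenbasis, not only in the one chosen by
    [spectralmx]. *)
Lemma udiag_fun P Q a b (f : R -> R) : P \is unitarymx -> Q \is unitarymx ->
  udiag P a = udiag Q b -> udiag P (f \o a) = udiag Q (f \o b).
Proof.
move=> uP uQ E.
have /(rdiag_intertwine f) {}E : rdiag a *m (P *m Q^t*) = (P *m Q^t*) *m rdiag b.
  have := congr1 (fun X => P *m X *m Q^t*) E; rewrite /udiag !mulmxA.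
  rewrite (unitarymxP uP) mul1mx => ->.
  by rewrite -[LHS]mulmxA (unitarymxP uQ) mulmx1.
rewrite /udiag -[Q^t*]mul1mx -(mul_adj_unitarymx uP) -[P^t* *m P *m Q^t*]mulmxA.
rewrite -[P^t* *m _ *m rdiag _]mulmxA -E !mulmxA -[RHS]mulmxA.
by rewrite (mul_adj_unitarymx uQ) mulmx1.
Qed.

Lemma mxpowR_udiag P a x : P \is unitarymx ->
  mxpowR (udiag P a) x = udiag P (fun i => a i `^ x).
Proof.
move=> uP; set A := udiag P a.
have hA : A \is hermsymmx by rewrite qualifE /= expr0 scale1r udiag_adj.
have uQ := spectral_unitarymx A; have := hermitian_normalmx hA.
move=> /orthomx_spectralP AE; have rA := hermitian_spectral_diag_real hA.
pose d i := complex.Re (spectral_diag A 0 i).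
have dE i : spectral_diag A 0 i = (d i)%:C.
  by rewrite RRe_real //; move/mxOverP: rA.
have sdE : spectral_diag A = \row_i (d i)%:C.
  by apply/rowP => i; rewrite mxE dE.
have {AE} : udiag (spectralmx A) d = udiag P a.
  rewrite -[RHS]/A; move: AE; rewrite (invmx_unitary uQ).
  by move: (spectralmx A) sdE => S -> ->.
move/(udiag_fun (@powR R ^~ x) uQ uP) => <-.
rewrite /mxpowR (invmx_unitary uQ).
rewrite (_ : map_mx _ _ = \row_i (d i `^ x)%:C) //.
by apply/rowP => i; rewrite !mxE.
Qed.

End UnitaryDiagonal.

(** * Eigenvalue comparison, as Loewner domination up to unitary conjugation *)

Section Domination.
Context {R : realType} {N : nat}.
Implicit Types (A B M K P Q W L : 'M[R[i]]_N) (v : 'cV[R[i]]_N) (x c : R).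
Implicit Types (a b : 'I_N -> R).

Definition antitone a := forall i j : 'I_N, (i <= j)%N -> a j <= a i.

Lemma antitone_perm a : exists s : 'S_N, antitone (a \o s).
Proof.
pose t := [tuple a i | i < N].
have /tuple_permP[s sE] : perm_eq (sort_tuple >=%R t) t by rewrite perm_sort.
exists s => i j ij.
have srt : sorted >=%R (sort_tuple >=%R t) by apply: sort_sorted; exact: ge_total.
have aE k : (a \o s) k = nth 0 (sort_tuple >=%R t) k.
  by rewrite sE -tnth_nth !tnth_map !tnth_ord_tuple.
rewrite !aE.
apply: (sorted_leq_nth ge_trans ge_refl) => //;
  by rewrite inE size_tuple.
Qed.

Lemma perm_mx_unitary (s : 'S_N) : (perm_mx s : 'M[R[i]]_N) \is unitarymx.
Proof. by apply/unitarymxP; rewrite tr_perm_mx map_perm_mx -perm_mxM mulgV perm_mx1. Qed.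

Lemma udiag_perm P a (s : 'S_N) :
  udiag P a = udiag (perm_mx s *m P) (a \o s).
Proof.
have E : rdiag (a \o s) *m perm_mx s = perm_mx s *m rdiag a :> 'M[R[i]]_N.
  apply/matrixP => i j; rewrite -row_permE /rdiag mul_diag_mx !mxE.
  by rewrite mulr_natr.
rewrite /udiag adjmxM -!mulmxA (mulmxA (rdiag _)) E.
rewrite -(mulmxA (perm_mx s)) (mulmxA ((perm_mx s)^t*)).
by rewrite (mul_adj_unitarymx (perm_mx_unitary s)) mul1mx.
Qed.

(** The eigenvalues are sorted so that two spectra can be compared index by index. *)
Lemma psd_udiag A : psdmx A ->
  exists P a, [/\ P \is unitarymx, antitone a, (forall i, 0 <= a i) & A = udiag P a].
Proof.
move=> psdA; have /psdP[hA A0] := psdA.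
have uQ := spectral_unitarymx A; have := hermitian_normalmx psdA.1.
move=> /orthomx_spectralP AE; have rA := hermitian_spectral_diag_real psdA.1.
pose d i := complex.Re (spectral_diag A 0 i).
have sdE : spectral_diag A = \row_i (d i)%:C.
  by apply/rowP => i; rewrite mxE RRe_real //; move/mxOverP: rA.
have {}AE : A = udiag (spectralmx A) d.
  by move: AE; rewrite (invmx_unitary uQ) sdE.
move: (spectralmx A) d uQ AE {sdE} => S d uQ AE.
have d0 i : 0 <= d i.
  (* The test vector is the i-th eigenvector, where the form takes the value [d i]. *)
  have := A0 (S^t* *m delta_mx i 0); rewrite AE.
  rewrite qform_udiagE mulmxA (unitarymxP uQ) mul1mx (bigD1 i) //= big1.
    by rewrite mxE !eqxx /= expr1n expr0n /= !addr0 mulr1.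
  by move=> j ji; rewrite mxE (negbTE ji) /= !expr0n /= addr0 mulr0.
have [s sE] := antitone_perm d.
exists (perm_mx s *m S), (d \o s); split.
- exact: mul_unitarymx (perm_mx_unitary s) uQ.
- exact: sE.
- by move=> i; exact: d0.
- by rewrite -udiag_perm.
Qed.

(** [high] and [low] describe the spectral subspaces of [udiag P a] for eigenvalues at least [c] and
    below [c], through the coordinates of [v] in the eigenbasis. *)
Definition high P a c v := forall i, a i < c -> (P *m v) i 0 = 0.
Definition low P a c v := forall i, c <= a i -> (P *m v) i 0 = 0.

Lemma high_qform P a c v : P \is unitarymx -> high P a c v ->
  c * qform 1%:M v <= qform (udiag P a) v.
Proof.
move=> uP hv; rewrite -(qform1_unitary v uP) qform1E qform_udiagE mulr_sumr.
apply: ler_sum => i _; have [ca|ac] := leP c (a i).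
  by rewrite ler_wpM2r // addr_ge0 ?sqr_ge0.
by rewrite hv //= !expr0n /= addr0 !mulr0.
Qed.

Lemma low_qform P a c v : P \is unitarymx -> v != 0 -> low P a c v ->
  qform (udiag P a) v < c * qform 1%:M v.
Proof.
move=> uP v0 hv; rewrite -(qform1_unitary v uP) qform1E qform_udiagE mulr_sumr.
have le i : a i * (complex.Re ((P *m v) i 0) ^+ 2 + complex.Im ((P *m v) i 0) ^+ 2)
         <= c * (complex.Re ((P *m v) i 0) ^+ 2 + complex.Im ((P *m v) i 0) ^+ 2).
  have [ca|ac] := leP c (a i).
    by rewrite hv //= !expr0n /= addr0 !mulr0.
  by rewrite ler_wpM2r ?(ltW ac) // addr_ge0 ?sqr_ge0.
(* Equality of the sums forces equality in each term, so every coordinate with eigenvalue below [c]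
   vanishes as well. *)
rewrite lt_def ler_sum ?andbT //; apply: contra_neq v0 => E.
have Pv0 : P *m v = 0.
  apply/matrixP => i j; rewrite ord1 [RHS]mxE.
  have [ca|ac] := leP c (a i); first exact: hv.
  move/eqP: E; rewrite -subr_eq0 -sumrB psumr_eq0 => [|k _]; last by rewrite subr_ge0.
  move=> /allP/(_ i (mem_index_enum _)) /=; rewrite -mulrBl mulf_eq0 subr_eq0.
  rewrite gt_eqF //= paddr_eq0 ?sqr_ge0 // !sqrf_eq0.
  by case: ((P *m v) i 0) => u w /= /andP[/eqP-> /eqP->].
by rewrite -[v]mul1mx -(mul_adj_unitarymx uP) -mulmxA Pv0 mulmx0.
Qed.

Definition udom A B := exists2 W, W \is unitarymx & loewner_le (W *m A *m W^t*) B.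

(* If [b k < a k], the vectors with [P v] supported on the first [k + 1]
   coordinates and [Q (L v)] vanishing on the first [k] of them solve a square
   linear system with a zero row. *)
Lemma udom_udiag P Q a b : P \is unitarymx -> Q \is unitarymx ->
  antitone a -> antitone b -> (forall i, 0 <= b i) ->
  (forall c, 0 < c -> exists L, forall v, v != 0 ->
     high P a c v -> low Q b c (L *m v) -> False) ->
  udom (udiag P a) (udiag Q b).
Proof.
move=> uP uQ aa ab b0 H.
have le k : a k <= b k.
  rewrite leNgt; apply/negP => ba.
  (* The level is the eigenvalue that violates the comparison; it is positive because it exceeds
     [b k]. *)
  have [L HL] := H (a k) (le_lt_trans (b0 k) ba).
  pose G : 'M[R[i]]_N := \matrix_(i, j)
    if (i < k)%N then (Q *m L) i j else if (k < i)%N then P i j else 0.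
  have /det0P[u u0 uG] : \det G^T == 0.
    rewrite det_tr; apply/det0P; exists (delta_mx 0 k).
      apply/eqP => /matrixP/(_ 0 k); rewrite !mxE !eqxx; apply/eqP; exact: oner_neq0.
    by rewrite -rowE; apply/rowP => j; rewrite !mxE ltnn.
  have {uG} Gu : G *m u^T = 0 by apply: trmx_inj; rewrite trmx_mul trmxK uG trmx0.
  apply: (HL u^T); first by rewrite -trmx0 (inj_eq trmx_inj).
  - move=> i ai; have ki : (k < i)%N.
      by rewrite ltnNge; apply: contraL ai => ik; rewrite -leNgt aa.
    have := congr1 (fun X : 'cV_N => X i 0) Gu; rewrite [RHS]mxE => <-.
    rewrite !mxE; apply: eq_bigr => j _; rewrite !mxE.
    by rewrite ltnNge (ltnW ki) ki.
  - move=> i ai; have ki : (i < k)%N.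
      rewrite ltnNge; apply/negP => ik.
      by have := le_lt_trans (le_trans ai (ab _ _ ik)) ba; rewrite ltxx.
    have := congr1 (fun X : 'cV_N => X i 0) Gu; rewrite [RHS]mxE => <-.
    by rewrite mulmxA !mxE; apply: eq_bigr => j _; rewrite !mxE ki.
(* This unitary maps each eigenvector of the first matrix to the eigenvector of the second with the
   same index. *)
exists (Q^t* *m P); first exact: mul_unitarymx (adj_unitarymx uQ) uP.
rewrite (udiag_conj _ _ uP); apply: loewnerI => [||v].
- exact: udiag_adj.
- exact: udiag_adj.
- exact: qform_udiag_le.
Qed.

End Domination.

(** * Tangent lines of the power function *)

Section PowerTangent.
Context {R : realType}.
Implicit Types (r a t x : R).

(** For r > 1 this is Young's inequality for t and a^(r-1), with conjugate exponents r and r/(r-1);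
    the slope is the derivative r a^(r-1). *)
Lemma powR_tangent_ge1 r a : 1 <= r -> 0 < a ->
  exists2 s, 0 <= s & forall t, 0 <= t -> (a `^ r - s * a) + s * t <= t `^ r.
Proof.
rewrite le_eqVlt => /predU1P[<-|r1] a0.
  by exists 1 => // t t0; rewrite !powRr1 ?(ltW a0) // !mul1r subrr add0r.
have r0 : 0 < r by lra.
exists (r * a `^ (r - 1)); first by rewrite mulr_ge0 ?powR_ge0 // ltW.
move=> t t0.
have q0 : 0 < r / (r - 1) by rewrite divr_gt0 // subr_gt0.
have qE : r^-1 + (r / (r - 1))^-1 = 1.
  by rewrite invf_div; field; rewrite gt_eqF.
have := conjugate_powR t0 (powR_ge0 a (r - 1)) r0 q0 qE.
have -> : (a `^ (r - 1)) `^ (r / (r - 1)) = a `^ r.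
  by rewrite -powRrM mulrC divfK // subr_eq0 gt_eqF.
rewrite -(mulr_powRB1 (ltW a0) r0); set y := a `^ (r - 1); set z := t `^ r.
rewrite -(ler_pM2l r0) mulrDr (mulrC r (z / r)) divfK ?gt_eqF //.
have -> : r * (a * y / (r / (r - 1))) = a * y * (r - 1).
  by field; rewrite !gt_eqF // subr_gt0.
by lra.
Qed.

(** For r < 1 this is Young's inequality for t^r and a^(1-r), with exponents 1/r and 1/(1-r). The
    slope is strictly positive, which later allows dividing by it. *)
Lemma powR_tangent_le1 r a : 0 < r <= 1 -> 0 < a ->
  exists2 s, 0 < s & forall t, 0 <= t -> t `^ r <= (a `^ r - s * a) + s * t.
Proof.
move=> /andP[r0]; rewrite le_eqVlt => /predU1P[->|r1] a0.
  by exists 1 => // t t0; rewrite !powRr1 ?(ltW a0) // !mul1r subrr add0r.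
have y0 : 0 < a `^ (1 - r) by exact: powR_gt0.
exists (r / a `^ (1 - r)); first by rewrite divr_gt0.
move=> t t0.
have q0 : 0 < (1 - r)^-1 by rewrite invr_gt0 subr_gt0.
have qE : r^-1^-1 + (1 - r)^-1^-1 = 1 by rewrite !invrK; ring.
have p0 : 0 < r^-1 by rewrite invr_gt0.
have := conjugate_powR (powR_ge0 t r) (ltW y0) p0 q0 qE.
rewrite -!powRrM !mulfV ?gt_eqF ?subr_gt0 // !powRr1 ?(ltW a0) // !invrK.
have -> : a `^ r = a / a `^ (1 - r).
  apply: (mulIf (lt0r_neq0 y0)); rewrite divfK ?gt_eqF // -powRD subrKC ?oner_eq0 //.
  by rewrite powRr1 // ltW.
set y := a `^ (1 - r) in y0 *; set z := t `^ r => zy.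
have -> : a / y - r / y * a + r / y * t = (t * r + a * (1 - r)) / y.
  by field; rewrite gt_eqF.
by rewrite ler_pdivlMr.
Qed.

(** The equality case of Jensen's inequality, with n equal terms x/n; it accounts for the constant
    n^(r-1). *)
Lemma powR_mean (n : nat) r x : (0 < n)%N -> 0 < r -> 0 <= x ->
  n%:R `^ (r - 1) * (n%:R * (x / n%:R) `^ r) = x `^ r.
Proof.
move=> n0 r0 x0; have n0' : 0 < n%:R :> R by rewrite ltr0n.
rewrite powRM ?invr_ge0 ?ler0n // -powR_inv1 ?ler0n // -powRrM mulN1r powRN.
rewrite mulrCA !mulrA mulr_powRB1 ?ler0n // mulrAC divff ?mul1r //.
by rewrite gt_eqF // powR_gt0.
Qed.

End PowerTangent.

(** * Powers of positive semidefinite matrices, their quadratic forms and Jensen comparisons *)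

Section MatrixPower.
Context {R : realType} {N : nat}.
Implicit Types (A B C D X Y T M K L : 'M[R[i]]_N) (v : 'cV[R[i]]_N).
Implicit Types (r s x c : R).

Lemma mxpowR_psd A r : psdmx A -> psdmx (mxpowR A r).
Proof.
move=> /psd_udiag[P [a [uP _ a0 ->]]]; rewrite (mxpowR_udiag _ _ uP).
by apply: udiag_psd => i; exact: powR_ge0.
Qed.

Lemma mxpowR_adj A r : psdmx A -> (mxpowR A r)^t* = mxpowR A r.
Proof. by move=> /(mxpowR_psd r)/psdP[]. Qed.

Lemma mxpowR1 A : psdmx A -> mxpowR A 1 = A.
Proof.
move=> /psd_udiag[P [a [uP _ a0 ->]]]; rewrite (mxpowR_udiag _ _ uP).
by apply: eq_udiag => i; rewrite powRr1.
Qed.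

Lemma mxpowRM A r s : psdmx A -> mxpowR (mxpowR A r) s = mxpowR A (r * s).
Proof.
move=> /psd_udiag[P [a [uP _ a0 ->]]]; rewrite !(mxpowR_udiag _ _ uP).
by apply: eq_udiag => i; rewrite powRrM.
Qed.

(** The condition on the exponents concerns zero eigenvalues: for nonzero r the product of the
    powers r and -r of 0 is 0, while the power 0 of 0 is 1. *)
Lemma mxpowRD A r s : psdmx A -> r + s != 0 ->
  mxpowR A r *m mxpowR A s = mxpowR A (r + s).
Proof.
move=> /psd_udiag[P [a [uP _ a0 ->]]] rs0; rewrite !(mxpowR_udiag _ _ uP) (udiagM _ _ uP).
by apply: eq_udiag => i; rewrite powRD // (negbTE rs0).
Qed.

Lemma mxpowR_half A r : psdmx A -> 0 < r ->
  mxpowR A (r / 2) *m mxpowR A (r / 2) = mxpowR A r.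
Proof.
move=> psdA r0; have rr : r / 2 + r / 2 = r by field.
by rewrite (mxpowRD psdA) rr // gt_eqF.
Qed.

(** Both sides are diagonal in one eigenbasis of [A], so the scalar inequality transfers eigenvalue
    by eigenvalue. *)
Lemma qform_mxpowR_ge A r c s v : psdmx A ->
  (forall t, 0 <= t -> c + s * t <= t `^ r) ->
  c * qform 1%:M v + s * qform A v <= qform (mxpowR A r) v.
Proof.
move=> /psd_udiag[P [a [uP _ a0 ->]]] cs; rewrite (mxpowR_udiag _ _ uP).
rewrite -(udiag1 uP) -!qformZ !udiagZ -qformD udiagD.
by apply: qform_udiag_le => i; rewrite mulr1 cs.
Qed.

Lemma qform_mxpowR_le A r c s v : psdmx A ->
  (forall t, 0 <= t -> t `^ r <= c + s * t) ->
  qform (mxpowR A r) v <= c * qform 1%:M v + s * qform A v.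
Proof.
move=> /psd_udiag[P [a [uP _ a0 ->]]] cs; rewrite (mxpowR_udiag _ _ uP).
rewrite -(udiag1 uP) -!qformZ !udiagZ -qformD udiagD.
by apply: qform_udiag_le => i; rewrite mulr1 cs.
Qed.

Lemma antitone_powR (a : 'I_N -> R) r : 0 <= r -> (forall i, 0 <= a i) ->
  antitone a -> antitone (fun i => a i `^ r).
Proof. by move=> r0 a0 aa i j ij; apply: ge0_ler_powR; rewrite ?nnegrE ?aa. Qed.

Lemma powR_root r c : 0 < r -> 0 < c -> exists2 x, 0 < x & x `^ r = c.
Proof.
move=> r0 c0; exists (c `^ r^-1); first exact: powR_gt0.
by rewrite -powRrM mulVf ?gt_eqF // powRr1 // ltW.
Qed.

(** The spectral subspace of X^r at level x^r is that of X at level x, and there the form of X is at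
    least x. The criterion of [udom_udiag] thus reduces to an implication between quadratic
    forms. *)
Lemma udom_mxpowRl X B r : psdmx X -> psdmx B -> 0 < r ->
  (forall x, 0 < x -> exists L, forall v, v != 0 ->
     x * qform 1%:M v <= qform X v ->
     L *m v != 0 /\ x `^ r * qform 1%:M (L *m v) <= qform B (L *m v)) ->
  udom (mxpowR X r) B.
Proof.
move=> /psd_udiag[P [a [uP aa a0 ->]]] /psd_udiag[Q [b [uQ ab b0 ->]]] r0 H.
rewrite (mxpowR_udiag _ _ uP); apply: (udom_udiag uP uQ) => //.
  by apply: antitone_powR => //; exact: ltW.
move=> c c0; have [x x0 <-] := powR_root r0 c0; have [L HL] := H x x0.
exists L => v v0 hv; have {}hv : high P a x v.
  by move=> i ai; apply: hv; apply: gt0_ltr_powR; rewrite ?nnegrE // ltW.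
have [Lv0 le] := HL v v0 (high_qform uP hv).
by move=> /(low_qform uQ Lv0); rewrite ltNge le.
Qed.

Lemma udom_mxpowRr A X r : psdmx A -> psdmx X -> 0 < r ->
  (forall x, 0 < x -> exists L, forall v, v != 0 ->
     x `^ r * qform 1%:M v <= qform A v ->
     L *m v != 0 /\ x * qform 1%:M (L *m v) <= qform X (L *m v)) ->
  udom A (mxpowR X r).
Proof.
move=> /psd_udiag[P [a [uP aa a0 ->]]] /psd_udiag[Q [b [uQ ab b0 ->]]] r0 H.
rewrite (mxpowR_udiag _ _ uQ); apply: (udom_udiag uP uQ) => //.
- by apply: antitone_powR => //; exact: ltW.
- by move=> i; exact: powR_ge0.
move=> c c0; have [x x0 <-] := powR_root r0 c0; have [L HL] := H x x0.
exists L => v v0 /(high_qform uP)/(HL v v0)[Lv0 le] lv; have : low Q b x (L *m v).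
  by move=> i ai; apply: lv; apply: ge0_ler_powR; rewrite ?nnegrE // ltW.
by move=> /(low_qform uQ Lv0); rewrite ltNge le.
Qed.

Lemma udom_mxpowR_sum_ge1 n (Y : 'I_n -> 'M[R[i]]_N) r :
  (forall j, psdmx (Y j)) -> 1 <= r ->
  udom (mxpowR (\sum_j Y j) r)
       ((n%:R `^ (r - 1))%:C *: \sum_j mxpowR (Y j) r).
Proof.
move=> psdY r1; have r0 := lt_le_trans ltr01 r1.
apply: udom_mxpowRl => //; first exact: psdmx_sum.
  by apply: psdmxZ (powR_ge0 _ _) _; apply: psdmx_sum => j; exact: mxpowR_psd.
move=> x x0; exists 1%:M => v v0; rewrite mul1mx => xv; split=> [//|].
have vpos := qform1_gt0 v0; rewrite qformZ qform_sum.
(* For n = 0 the sum is empty and could not reach the positive level x |v|^2. *)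
rewrite qform_sum in xv; have n0 : (0 < n)%N.
  rewrite lt0n; apply: contraL xv => /eqP n0; rewrite -ltNge big1.
    by rewrite mulr_gt0.
  by move=> j _; have := ltn_ord j; rewrite {2}n0.
have n0' : 0 < n%:R :> R by rewrite ltr0n.
(* Tangency at x/n makes the n intercepts and slopes add up to n (x/n)^r |v|^2 plus s times the
   excess of the form of the sum over x |v|^2. *)
have [s s0 tan] := powR_tangent_ge1 r1 (divr_gt0 x0 n0').
rewrite -(powR_mean n0 r0 (ltW x0)) -mulrA (ler_wpM2l (powR_ge0 _ _)) //.
have : \sum_(j < n) (((x / n%:R) `^ r - s * (x / n%:R)) * qform 1%:M v
                      + s * qform (Y j) v) <= \sum_(j < n) qform (mxpowR (Y j) r) v.
  by apply: ler_sum => j _; exact: qform_mxpowR_ge (psdY j) tan.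
apply: le_trans; rewrite big_split /= sumr_const card_ord -mulr_sumr.
rewrite -[X in X + _]mulr_natl.
have := ler_wpM2l s0 xv; set y := (x / n%:R) `^ r; set u := qform _ v.
have -> : n%:R * ((y - s * (x / n%:R)) * u) = n%:R * y * u - s * (x * u).
  by field; rewrite gt_eqF.
by lra.
Qed.

Lemma udom_mxpowR_sum_le1 n (Y : 'I_n -> 'M[R[i]]_N) r :
  (forall j, psdmx (Y j)) -> 0 < r <= 1 ->
  udom ((n%:R `^ (r - 1))%:C *: \sum_j mxpowR (Y j) r)
       (mxpowR (\sum_j Y j) r).
Proof.
move=> psdY r01; have /andP[r0 r1] := r01.
apply: udom_mxpowRr => [|||x x0]; last 1 first.
- exists 1%:M => v v0; rewrite !mul1mx qformZ !qform_sum => xv; split=> [//|].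
  have vpos := qform1_gt0 v0; have n0 : (0 < n)%N.
    rewrite lt0n; apply: contraL xv => /eqP n0; rewrite -ltNge [X in _ * X]big1.
      by rewrite mulr0 mulr_gt0 ?powR_gt0.
    by move=> j _; have := ltn_ord j; rewrite {2}n0.
  have n0' : 0 < n%:R :> R by rewrite ltr0n.
  have [s s0 tan] := powR_tangent_le1 r01 (divr_gt0 x0 n0').
  have : \sum_(j < n) qform (mxpowR (Y j) r) v <=
    \sum_(j < n) (((x / n%:R) `^ r - s * (x / n%:R)) * qform 1%:M v
                  + s * qform (Y j) v).
    by apply: ler_sum => j _; exact: qform_mxpowR_le (psdY j) tan.
  rewrite big_split /= sumr_const card_ord -mulr_sumr -[X in X + _]mulr_natl.
  move: xv; rewrite -(powR_mean n0 r0 (ltW x0)) -mulrA ler_pM2l ?powR_gt0 //.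
  set y := (x / n%:R) `^ r; set u := qform _ v.
  have -> : n%:R * ((y - s * (x / n%:R)) * u) = n%:R * y * u - s * (x * u).
    by field; rewrite gt_eqF.
  (* The same sum of tangents now bounds s times the excess from below by 0, and s > 0 can be
     cancelled. *)
  by move=> h1 h2; rewrite -(ler_pM2l s0); lra.
- by apply: psdmxZ (powR_ge0 _ _) _; apply: psdmx_sum => j; exact: mxpowR_psd.
- exact: psdmx_sum.
- exact: r0.
Qed.

(* This is [|(C C^* - c) v|^2 >= 0]; it transports a lower spectral bound from
   [C C^* ] to [C^* C]. *)
Lemma qform_gram_swap C c v : 0 <= c ->
  c * qform 1%:M v <= qform 1%:M (C^t* *m v) ->
  c * qform 1%:M (C^t* *m v) <= qform 1%:M (C *m (C^t* *m v)).
Proof.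
move=> c0 cv; pose G := C *m C^t*.
have := qform1_ge0 ((G - c%:C *: 1%:M) *m v).
have hG : G^t* = G by rewrite /G adjmxM trmxCK.
have h1 : (c%:C *: 1%:M : 'M[R[i]]_N)^t* = c%:C *: 1%:M.
  by rewrite adjmxZ_real; congr (_ *: _); rewrite trmx1 map_mx1.
rewrite -qform_gram adjmxB h1 hG mulmxBl [G *m _]mulmxBr -scalemxAr mulmx1.
rewrite -scalemxAl mul1mx qformB qformB (qformZ c G) (qformZ c (G - _)) qformB.
rewrite (qformZ c 1%:M).
have -> : qform (G *m G) v = qform 1%:M (C *m (C^t* *m v)).
  by rewrite -{1}hG qform_gram -mulmxA.
have -> : qform G v = qform 1%:M (C^t* *m v) by rewrite -qform_gram trmxCK.
move: cv; set x := qform _ _; set y := qform _ _; set z := qform _ _ => cv.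
by move: (ler_wpM2l c0 cv); move: x y z {cv} => x y z; lra.
Qed.

(** If |K^* v|^2 = d |v|^2 with d > 1, then [qform_gram_swap] shows that K stretches K^* v by a
    factor d in squared norm, which is impossible. *)
Lemma contraction_adj K : (forall v, qform 1%:M (K *m v) <= qform 1%:M v) ->
  forall v, qform 1%:M (K^t* *m v) <= qform 1%:M v.
Proof.
move=> cK v; rewrite leNgt; apply/negP => lt.
pose d := qform 1%:M (K^t* *m v) / qform 1%:M v.
have v0 : 0 < qform 1%:M v.
  rewrite lt_def qform1_ge0 andbT; apply: contraTneq lt => E.
  have : v == 0 by apply: contraTT isT => /qform1_gt0; rewrite E ltxx.
  by move/eqP->; rewrite mulmx0 ltxx.
have d1 : 1 < d by rewrite /d ltr_pdivlMr // mul1r.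
have := @qform_gram_swap K d v (ltW (lt_trans ltr01 d1)).
rewrite {1}/d divfK ?gt_eqF // => /(_ (lexx _)) le.
have := le_trans le (cK _); rewrite ger_pMl ?leNgt ?d1 //.
exact: lt_trans v0 lt.
Qed.

(** * Jensen's inequality for compression by a contraction *)

Section Contraction.
Variables (K T X : 'M[R[i]]_N) (r : R).
Hypotheses (psdT : psdmx T) (XE : K *m T *m K^t* = X) (r0 : 0 < r).
Hypothesis contrK : forall v, qform 1%:M (K^t* *m v) <= qform 1%:M v.

Let C := K *m mxpowR T (r / 2).

Let psdX : psdmx X.
Proof. by rewrite -XE -{1}[K]trmxCK; exact: psdmx_congr. Qed.

Let qformC v : qform 1%:M (C^t* *m v) = qform (mxpowR T r) (K^t* *m v).
Proof.
rewrite -(mxpowR_half psdT r0) /C adjmxM (mxpowR_adj _ psdT) -mulmxA.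
by rewrite -[in LHS]qform_gram (mxpowR_adj _ psdT).
Qed.

Let qformT v : qform T (K^t* *m v) = qform X v.
Proof. by rewrite -qform_congr trmxCK XE. Qed.

Lemma udom_contraction_ge1 : 1 <= r -> udom (mxpowR X r) (C^t* *m C).
Proof.
move=> r1; apply: udom_mxpowRl => [|||x x0]; last 1 first.
- exists (C^t*) => v v0 xv; have vpos := qform1_gt0 v0.
  have le : x `^ r * qform 1%:M v <= qform 1%:M (C^t* *m v).
    have [s s0 tan] := powR_tangent_ge1 r1 x0; rewrite qformC.
    apply: le_trans (qform_mxpowR_ge _ psdT tan); rewrite qformT.
    (* At t = 0 the tangent bound shows that the intercept is nonpositive. Multiplying it by |v|^2
       instead of the smaller |K^* v|^2 therefore only lowers the bound; this is where contractivity
       enters. *)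
    have := tan 0 (lexx 0); rewrite powR0 ?gt_eqF // mulr0 addr0 => al.
    move: (ler_wnM2l al (contrK v)) (ler_wpM2l s0 xv).
    move: (qform 1%:M (K^t* *m v)) (qform 1%:M v) (qform X v) (x `^ r) => q1 q2 q3 y.
    by lra.
  split; last by rewrite qform_gram; apply: qform_gram_swap (powR_ge0 _ _) le.
  apply: contraTneq le => ->; rewrite -ltNge qform1E big1 => [|i _].
    by rewrite mulr_gt0 ?powR_gt0.
  by rewrite mxE /= !expr0n /= addr0.
- exact: psdX.
- exact: psdmx_gram.
- exact: r0.
Qed.

Lemma udom_contraction_le1 : r <= 1 -> udom (C^t* *m C) (mxpowR X r).
Proof.
move=> r1; apply: udom_mxpowRr => [|||x x0]; last 1 first.
- exists C => v v0; rewrite qform_gram => xv; have vpos := qform1_gt0 v0.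
  have Cv0 : C *m v != 0.
    apply: contraTneq xv => ->; rewrite -ltNge [ltLHS]qform1E big1 => [|i _].
      by rewrite mulr_gt0 ?powR_gt0.
    by rewrite mxE /= !expr0n /= addr0.
  split=> [//|]; have := @qform_gram_swap (C^t*) _ v (powR_ge0 x r).
  rewrite trmxCK => /(_ xv); move: (C *m v) => w; rewrite qformC => le.
  have r01 : 0 < r <= 1 by rewrite r0.
  have [s s0 tan] := powR_tangent_le1 r01 x0.
  (* Here the intercept is nonnegative, so |K^* w|^2 may be replaced by the larger |w|^2 in an upper
     bound. *)
  have := tan 0 (lexx 0); rewrite powR0 ?gt_eqF // mulr0 addr0 => al.
  have := qform_mxpowR_le (K^t* *m w) psdT tan; rewrite qformT => le2.
  rewrite -(ler_pM2l s0); move: le le2 (ler_wpM2l al (contrK w)).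
  move: (qform (mxpowR T r) _) (qform 1%:M (K^t* *m w)) (qform 1%:M w) (qform X w).
  by move: (x `^ r) => y q1 q2 q3 q4; lra.
- exact: psdmx_gram.
- exact: psdX.
- exact: r0.
Qed.

End Contraction.

End MatrixPower.

(** * Factoring a matrix below T through T, with T possibly singular *)

Section Rearrangement.
Context {R : realType} {N : nat}.
Implicit Types (X T K : 'M[R[i]]_N) (v : 'cV[R[i]]_N) (r : R).

Lemma mulmx_cV_eq0 (M : 'M[R[i]]_N) : (forall v, M *m v = 0) -> M = 0.
Proof.
move=> M0; apply/matrixP => i j.
by have := congr1 (fun u : 'cV_N => u i 0) (M0 (delta_mx j 0)); rewrite -colE !mxE.
Qed.

Lemma powR_pinvr (r t : R) : 0 < r -> 0 <= t ->
  t `^ (r / 2) * t `^ (- 2^-1) * t * (t `^ (- 2^-1) * t `^ (r / 2)) = t `^ r.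
Proof.
move=> r0; rewrite le_eqVlt => /predU1P[<-|t0].
  by rewrite mulr0 mul0r powR0 // gt_eqF.
have -> : t `^ r = t `^ (r / 2) * t `^ (r / 2).
  by rewrite -powRD ?(gt_eqF t0) ?implybT //; congr (_ `^ _); field.
rewrite powRN powR12_sqrt ?ltW //; set s := Num.sqrt t.
have s0 : s != 0 by rewrite sqrtr_eq0 -ltNge.
by rewrite -[X in _ * X * _](sqr_sqrtr (ltW t0)) -/s; field.
Qed.

(* [0 `^ (- 2^-1) = 0], so [mxpowR T (- 2^-1)] is the square root of the
   Moore-Penrose inverse of [T]. *)
Lemma psd_factor X T : psdmx X -> psdmx T -> loewner_le X T ->
  exists K,
  [/\ K *m T *m K^t* = X,
      K^t* *m K = mxpowR T (- 2^-1) *m X *m mxpowR T (- 2^-1)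
    & forall v, qform 1%:M (K^t* *m v) <= qform 1%:M v].
Proof.
move=> psdX psdT XT; have [G [hG GG]] : exists G, G^t* = G /\ G *m G = X.
  exists (mxpowR X (1 / 2)); split; first exact: mxpowR_adj.
  by rewrite (mxpowR_half psdX ltr01) mxpowR1.
have [P [h [uP _ h0 TE]]] := psd_udiag psdT.
have : mxpowR T (- 2^-1) = udiag P (fun i => h i `^ (- 2^-1)).
  rewrite TE; exact: mxpowR_udiag.
move: (mxpowR T (- 2^-1)) (mxpowR_adj (- 2^-1) psdT) => S hS SE.
exists (G *m S); rewrite adjmxM hG hS.
have KK : S *m G *m (G *m S) = S *m X *m S.
  by rewrite mulmxA -(mulmxA S) GG.
have leXT v : qform X v <= qform T v.
  by case/psdP: XT => _ /(_ v); rewrite qformB subr_ge0.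
(* These values are 1 at nonzero eigenvalues and 0 at zero ones, so S T S is the orthogonal
   projection onto the range of T and [E] below is the projection onto its kernel. *)
pose e i := h i `^ (- 2^-1) * h i * h i `^ (- 2^-1).
have STS : S *m T *m S = udiag P e.
  rewrite SE TE (udiagM _ _ uP) (udiagM _ _ uP).
  exact: eq_udiag.
have eE i : e i = (h i != 0)%:R.
  have := h0 i; rewrite /e le_eqVlt => /predU1P[<-|hi].
    by rewrite eqxx mulr0 mul0r.
  rewrite (gt_eqF hi) /= powRN powR12_sqrt ?ltW //; set s := Num.sqrt (h i).
  have s0 : s != 0 by rewrite sqrtr_eq0 -ltNge.
  by rewrite -[X in _ * X * _](sqr_sqrtr (ltW hi)) -/s; field.
pose E := 1%:M - udiag P e.
have EE : E = udiag P (fun i => 1 + -1 * e i).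
  by rewrite -udiagD -udiagZ (udiag1 uP) rmorphN1 scaleN1r.
have ETE : E^t* *m T *m E = 0.
  rewrite EE udiag_adj TE (udiagM _ _ uP) (udiagM _ _ uP).
  rewrite (@eq_udiag _ _ _ _ (fun=> 0 * 0)) => [|i].
    by rewrite -udiagZ rmorph0 scale0r.
  rewrite eE; case: eqVneq => [->|_] /=; first by rewrite mulr0 mul0r mulr0.
  by rewrite mulr1 subrr !mul0r.
(* |G E v|^2 is the form of X at E v, bounded by that of T, which vanishes on the kernel. So G
   absorbs the projection S T S, and K T K^* = G (S T S) G = X. *)
have GE : G *m E = 0.
  apply: mulmx_cV_eq0 => v; apply/eqP; apply: contraT => /qform1_gt0.
  rewrite -mulmxA -qform_gram hG GG ltNge (le_trans (leXT _)) //.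
  by rewrite -qform_congr ETE qform0.
have Gu : G *m udiag P e = G.
  by apply/esym/eqP; rewrite -subr_eq0 -{1}[G]mulmx1 -mulmxBr; apply/eqP.
split=> [|//|v].
- rewrite mulmxA -(mulmxA G S T) -(mulmxA G (S *m T) S) STS.
  by rewrite Gu GG.
(* It suffices that K is a contraction: K^* K = S X S is below S T S, a projection. *)
- have := @contraction_adj _ _ (G *m S); rewrite adjmxM hG hS; apply=> {v} v.
  rewrite -qform_gram adjmxM hG hS KK -{1}hS qform_congr (le_trans (leXT _)) //.
  rewrite -qform_congr hS STS -[X in _ <= qform X v](udiag1 uP).
  by apply: qform_udiag_le => i; rewrite eE; case: (_ != _).
Qed.

(** The pseudo-inverse suffices because r > 0: a zero eigenvalue of T contributes 0 to both
    sides. *)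
Lemma mxpowR_pinv T r : psdmx T -> 0 < r ->
  (mxpowR T (- 2^-1) *m mxpowR T (r / 2))^t* *m T
    *m (mxpowR T (- 2^-1) *m mxpowR T (r / 2)) = mxpowR T r.
Proof.
move=> psdT r0; rewrite (adjmxM_herm (mxpowR_adj _ psdT) (mxpowR_adj _ psdT)).
have [P [h [uP _ h0 ->]]] := psd_udiag psdT.
rewrite !(mxpowR_udiag _ _ uP) (udiagM _ _ uP) (udiagM _ _ uP) (udiagM _ _ uP).
by rewrite (udiagM _ _ uP); apply: eq_udiag => i; exact: powR_pinvr.
Qed.

Lemma psd_le_sum n (X : 'I_n -> 'M[R[i]]_N) i :
  (forall j, psdmx (X j)) -> loewner_le (X i) (\sum_j X j).
Proof.
move=> psdX; rewrite /loewner_le (bigD1 i) //= addrAC subrr add0r.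
by apply: (big_ind _ psdmx0 psdmxD) => j _; exact: psdX.
Qed.

End Rearrangement.

(** * Power sums of two families with the same total *)

Section PowerSums.
Context {R : realType} {N m n : nat}.
Variables (X : 'I_m -> 'M[R[i]]_N) (Y : 'I_n -> 'M[R[i]]_N).
Hypotheses (psdX : forall i, psdmx (X i)) (psdY : forall j, psdmx (Y j)).
Hypothesis XY : \sum_i X i = \sum_j Y j.
Implicit Types r : R.

Let T := \sum_i X i.

Let psdT : psdmx T.
Proof. exact: psdmx_sum. Qed.

(** Kept as a product: at r = 1 it is the projection onto the range of T, whereas [mxpowR T 0] is
    the identity. *)
Let F r := mxpowR T (- 2^-1) *m mxpowR T (r / 2).

(** Writing C_i^* C_i as F^* X_i F makes it linear in X_i, so that the sum over i collapses to
    T^r. *)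
Let factor r i : 0 < r -> exists K,
  [/\ K *m T *m K^t* = X i,
      (K *m mxpowR T (r / 2))^t* *m (K *m mxpowR T (r / 2)) = (F r)^t* *m X i *m F r
    & forall v, qform 1%:M (K^t* *m v) <= qform 1%:M v].
Proof.
move=> r0; have [K [KX KK cK]] := psd_factor (psdX i) psdT (psd_le_sum i psdX).
exists K; split=> [//||//].
rewrite /F (adjmxM_herm (mxpowR_adj _ psdT) (mxpowR_adj _ psdT)) adjmxM.
rewrite (mxpowR_adj _ psdT); move: (mxpowR T (r / 2)) (mxpowR T (- 2^-1)) KK.
by move=> D S KK; rewrite -mulmxA (mulmxA (K^t*)) KK !mulmxA.
Qed.

Let sumF r : 0 < r -> \sum_i (F r)^t* *m X i *m F r = mxpowR T r.
Proof. by move=> r0; rewrite -mulmx_suml -mulmx_sumr mxpowR_pinv. Qed.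

(** Each X_i^r is dominated by F^* X_i F through some W_i; these add up to T^r, which Jensen
    dominates through a single V. The resulting unitaries are V W_i. *)
Lemma sum_mxpowR_rearrange_ge1 r : 1 <= r ->
  exists2 W : 'I_m -> 'M[R[i]]_N, forall i, W i \is unitarymx
    & loewner_le (\sum_i W i *m mxpowR (X i) r *m (W i)^t*)
                 ((n%:R `^ (r - 1))%:C *: \sum_j mxpowR (Y j) r).
Proof.
move=> r1; have r0 := lt_le_trans ltr01 r1.
have /fin_all_exists[W HW] i : exists W, W \is unitarymx /\
    loewner_le (W *m mxpowR (X i) r *m W^t*) ((F r)^t* *m X i *m F r).
  have [K [KX KK cK]] := factor i r0.
  have [W uW] := udom_contraction_ge1 psdT KX r0 cK r1.
  by rewrite KK => le; exists W.
have [V uV] := udom_mxpowR_sum_ge1 psdY r1; rewrite -XY => leV.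
exists (fun i => V *m W i).
  by move=> i; exact: mul_unitarymx uV (HW i).1.
apply: loewner_le_trans leV.
have le := loewner_le_sum (index_enum _) (fun i => (HW i).2).
have := loewner_le_congr (V^t*) le.
rewrite (sumF r0) trmxCK mulmx_sumr mulmx_suml.
rewrite (eq_bigr (fun i => V *m W i *m mxpowR (X i) r *m (V *m W i)^t*)) // => i _.
by rewrite adjmxM !mulmxA.
Qed.

Lemma sum_mxpowR_rearrange_le1 r : 0 < r <= 1 ->
  exists2 W : 'I_m -> 'M[R[i]]_N, forall i, W i \is unitarymx
    & loewner_le ((n%:R `^ (r - 1))%:C *: \sum_j mxpowR (Y j) r)
                 (\sum_i W i *m mxpowR (X i) r *m (W i)^t*).
Proof.
move=> r01; have /andP[r0 r1] := r01.
have /fin_all_exists[W HW] i : exists W, W \is unitarymx /\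
    loewner_le ((F r)^t* *m X i *m F r) (W *m mxpowR (X i) r *m W^t*).
  have [K [KX KK cK]] := factor i r0.
  have [W uW] := udom_contraction_le1 psdT KX r0 cK r1.
  (* Domination conjugates the smaller side; transferring the unitary to X_i^r replaces it by its
     adjoint. *)
  rewrite KK => /(loewner_le_unitary uW) le; exists (W^t*); rewrite trmxCK.
  by split=> [|//]; exact: adj_unitarymx.
have [V uV] := udom_mxpowR_sum_le1 psdY r01; rewrite -XY.
move=> /(loewner_le_unitary uV) leV.
exists (fun i => V^t* *m W i).
  by move=> i; exact: mul_unitarymx (adj_unitarymx uV) (HW i).1.
apply: (loewner_le_trans leV).
have le := loewner_le_sum (index_enum _) (fun i => (HW i).2).
have := loewner_le_congr V le; rewrite (sumF r0) mulmx_sumr mulmx_suml.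
rewrite (eq_bigr (fun i => V^t* *m W i *m mxpowR (X i) r *m (V^t* *m W i)^t*)) // => i _.
by rewrite adjmxM trmxCK !mulmxA.
Qed.

End PowerSums.

(** * The quadratic symmetric modulus and its invariance under isometries *)

Section QuadraticSymmetric.
Context {R : realType} {N : nat}.
Implicit Types (Z : 'M[R[i]]_N).

Definition symgram Z := 2^-1 *: (Z^t* *m Z + Z *m Z^t*).

Lemma symgram_psd Z : psdmx (symgram Z).
Proof.
rewrite /symgram (_ : 2^-1 = (2^-1)%:C); last by rewrite fmorphV rmorph_nat.
apply: psdmxZ; first by rewrite invr_ge0 ler0n.
by apply: psdmxD (psdmx_gram Z) _; rewrite -{1}[Z]trmxCK; exact: psdmx_gram.
Qed.

Lemma mxpowR_qsym Z p : mxpowR (qsym Z) p = mxpowR (symgram Z) (p / 2).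
Proof. by rewrite mulrC -mxpowRM //; exact: symgram_psd. Qed.

(** The columns of U are orthonormal, so summing the coefficients over i leaves only the terms j =
    k. The array [G] is arbitrary to cover both A_j^* A_k and A_k A_j^*. *)
Lemma isometry_sum m n (U : 'M[R[i]]_(m, n)) (G : 'I_n -> 'I_n -> 'M[R[i]]_N) :
  U^t* *m U = 1%:M ->
  \sum_i \sum_j \sum_k (Num.conj (U i j) * U i k) *: G j k = \sum_j G j j.
Proof.
move=> isoU; have E j k : \sum_i Num.conj (U i j) * U i k = (j == k)%:R.
  have := congr1 (fun M : 'M_n => M j k) isoU; rewrite !mxE => <-.
  by apply: eq_bigr => i _; rewrite adjmxE.
rewrite exchange_big; apply: eq_bigr => j _ /=; rewrite exchange_big.
under eq_bigr => k _ do rewrite -scaler_suml E.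
rewrite (bigD1 j) //= eqxx scale1r [X in _ + X]big1 ?addr0 // => k kj.
by rewrite eq_sym (negbTE kj) scale0r.
Qed.

Lemma isometry_symgram m n (B : 'I_m -> 'M[R[i]]_N) (A : 'I_n -> 'M[R[i]]_N)
    (U : 'M[R[i]]_(m, n)) : U^t* *m U = 1%:M ->
  (forall i, B i = \sum_j U i j *: A j) ->
  \sum_i symgram (B i) = \sum_j symgram (A j).
Proof.
move=> isoU BA; rewrite /symgram -!scaler_sumr !big_split /=; congr (_ *: (_ + _)).
  rewrite -(isometry_sum (fun j k => (A j)^t* *m A k) isoU).
  apply: eq_bigr => i _; rewrite BA adjmx_sum mulmx_suml; apply: eq_bigr => j _.
  rewrite mulmx_sumr; apply: eq_bigr => k _.
  by rewrite adjmxZ -scalemxAl -scalemxAr scalerA.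
(* In B_i B_i^* the conjugated coefficient belongs to the second factor, so the array is indexed in
   swapped order. *)
rewrite -(isometry_sum (fun j k => A k *m (A j)^t*) isoU).
apply: eq_bigr => i _; rewrite BA adjmx_sum mulmx_sumr; apply: eq_bigr => j _.
rewrite mulmx_suml; apply: eq_bigr => k _.
by rewrite adjmxZ -scalemxAl -scalemxAr scalerA mulrC.
Qed.

End QuadraticSymmetric.

Theorem theorem1p19 (R : realType) (N m n : nat)
    (B : 'I_m -> 'M[R[i]]_N) (A : 'I_n -> 'M[R[i]]_N)
    (U : 'M[R[i]]_(m, n)) (isoU : U^t* *m U = 1%:M)
    (BA : forall i : 'I_m, B i = \sum_(j < n) U i j *: A j) (p : R) :
  (2 <= p ->
     exists (UU : 'I_m -> 'M[R[i]]_N) (VV : 'I_n -> 'M[R[i]]_N),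
       [/\ forall i : 'I_m, UU i \is unitarymx,
           forall j : 'I_n, VV j \is unitarymx,
           loewner_le
             (\sum_(i < m) UU i *m mxpowR (qsym (B i)) p *m (UU i)^t*)
             ((n%:R `^ (p / 2 - 1))%:C *: \sum_(j < n) mxpowR (qsym (A j)) p)
         & loewner_le
             (\sum_(j < n) VV j *m mxpowR (qsym (A j)) p *m (VV j)^t*)
             ((m%:R `^ (p / 2 - 1))%:C *: \sum_(i < m) mxpowR (qsym (B i)) p)])
  /\
  (0 < p <= 2 ->
     exists (UU : 'I_m -> 'M[R[i]]_N) (VV : 'I_n -> 'M[R[i]]_N),
       [/\ forall i : 'I_m, UU i \is unitarymx,
           forall j : 'I_n, VV j \is unitarymx,
           loewner_le
             ((n%:R `^ (p / 2 - 1))%:C *: \sum_(j < n) mxpowR (qsym (A j)) p)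
             (\sum_(i < m) UU i *m mxpowR (qsym (B i)) p *m (UU i)^t*)
         & loewner_le
             ((m%:R `^ (p / 2 - 1))%:C *: \sum_(i < m) mxpowR (qsym (B i)) p)
             (\sum_(j < n) VV j *m mxpowR (qsym (A j)) p *m (VV j)^t*)]).
Proof.
have psd k (Z : 'I_k -> 'M[R[i]]_N) i : psdmx (symgram (Z i)) by exact: symgram_psd.
have BAE := isometry_symgram isoU BA.
have powE k (Z : 'I_k -> 'M[R[i]]_N) :
    \sum_i mxpowR (qsym (Z i)) p = \sum_i mxpowR (symgram (Z i)) (p / 2).
  by apply: eq_bigr => i _; rewrite mxpowR_qsym.
have congE k (Z W : 'I_k -> 'M[R[i]]_N) :
    \sum_i W i *m mxpowR (qsym (Z i)) p *m (W i)^t*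
    = \sum_i W i *m mxpowR (symgram (Z i)) (p / 2) *m (W i)^t*.
  by apply: eq_bigr => i _; rewrite mxpowR_qsym.
have le_eq (S S' T T' : 'M[R[i]]_N) :
  S = S' -> T = T' -> loewner_le S' T' -> loewner_le S T by move=> -> ->.
split=> hp.
- have r1 : 1 <= p / 2 by rewrite ler_pdivlMr ?mul1r.
  have [UU uUU leU] := sum_mxpowR_rearrange_ge1 (psd m B) (psd n A) BAE r1.
  (* Only the equality of the two sums is used, so exchanging the families gives the second
     inequality, with m in place of n. *)
  have [VV uVV leV] := sum_mxpowR_rearrange_ge1 (psd n A) (psd m B) (esym BAE) r1.
  exists UU, VV; split; [exact: uUU | exact: uVV | |].
    exact: le_eq (congE _ B UU) (congr1 ( *:%R _) (powE _ A)) leU.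
  exact: le_eq (congE _ A VV) (congr1 ( *:%R _) (powE _ B)) leV.
- have r1 : 0 < p / 2 <= 1 by rewrite divr_gt0 ?ler_pdivrMr ?mul1r; case/andP: hp.
  have [UU uUU leU] := sum_mxpowR_rearrange_le1 (psd m B) (psd n A) BAE r1.
  have [VV uVV leV] := sum_mxpowR_rearrange_le1 (psd n A) (psd m B) (esym BAE) r1.
  exists UU, VV; split; [exact: uUU | exact: uVV | |].
    exact: le_eq (congr1 ( *:%R _) (powE _ A)) (congE _ B UU) leU.
  exact: le_eq (congr1 ( *:%R _) (powE _ B)) (congE _ A VV) leV.
Qed.
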